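(* Let $L/K$ be a finite Galois extension of fields with Galois group $(G,\circ)$, and let $G=(G,\cdot,\circ)$ be a skew brace which is the semidirect product of an ideal $A$ and a left ideal $B$. Let $H_G$, $H_A$, $H_B$ and $H_{\overline{A}}$ be the $K$-Hopf algebras described in the context. Let $\alpha \in L^{A}$ be a free generator of $L^{A}$ as an $H_{B}$-module and $\beta \in L^{B}$ be a free generator of $L^{B}$ as an $H_{\overline{A}}$-module. Then (1) $\beta$ is a free generator of $L$ as an $L^{A} \otimes_{K} H_{A}$-module; (2) $\alpha\beta$ is a free generator of $L$ as an $H_{G}$-module.
   Context: A (left) skew brace is a triple $(G,\cdot,\circ)$ in which $(G,\cdot)$ and $(G,\circ)$ are groups and $x \circ (y \cdot z) = (x \circ y) \cdot x^{-1} \cdot (x \circ z)$ for all $x,y,z \in G$, where $x^{-1}$ is the inverse for $\cdot$; $e$ is the common identity. Its $\gamma$-function is the homomorphism $\gamma : (G,\circ) \to \mathrm{Aut}(G,\cdot)$, $\gamma_x(y) = x^{-1}\cdot(x \circ y)$. A left ideal is a subset $A$ that is a subgroup with respect to either (hence both) operation(s) with $\gamma_x(A)=A$ for all $x\in G$; an ideal is a left ideal with $(A,\cdot)\trianglelefteq (G,\cdot)$ and $(A,\circ)\trianglelefteq(G,\circ)$. $G$ is the (internal) semidirect product of the ideal $A$ and left ideal $B$ if $A \cap B = \{e\}$, $A \cdot B = G$ and $A \circ B = G$. $L^A$, $L^B$ are the fixed fields of $(A,\circ)$, $(B,\circ)$. $(G,\circ)$ acts semilinearly on the group algebra $L[G,\cdot]$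 by $x \star \sum_{y} c_{y} y = \sum_{y} x(c_{y}) \gamma_{x}(y)$, preserving $L[A,\cdot]$ and $L[B,\cdot]$. The fixed rings $H_G=L[G,\cdot]^{(G,\circ)}$, $H_A=L[A,\cdot]^{(G,\circ)}$, $H_B=L[B,\cdot]^{(G,\circ)}$ are $K$-Hopf algebras and act on $L$ by $(\sum_y c_y y)[t]=\sum_y c_y\, y[t]$. The action of $H_A$ on $L$ is $L^A$-linear, so $L^A\otimes_K H_A$ acts on $L$ by $(s\otimes w)[t]=s\,w[t]$. The action of $H_B$ on $L$ restricts to an action on $L^A$; this is the $H_B$-module structure on $L^A$. Let $X=G/B$ be the left coset space of $(B,\circ)$ in $(G,\circ)$, whose elements are uniquely of the form $a\circ B$ with $a\in A$, and let $\lambda_X:(G,\circ)\to\mathrm{Perm}(X)$ be left translation. For $a\in A$ define $\overline{\rho_\cdot}(a)\in\mathrm{Perm}(X)$ by $\overline{\rho_\cdot}(a)[a'\circ B]=(a'\cdot a^{-1})\circ B$ for $a'\in A$, and let $\overline{A}=\overline{\rho_\cdot}(A)$; this is a regular subgroup of $\mathrm{Perm}(X)$ normalised by $\lambda_X(G)$. $(G,\circ)$ acts semilinearly on $L[\overline{A}]$ by $g\star\sum_{a} c_a\overline{\rho_\cdot}(a)=\sum_{a} g(c_a)\,\lambda_X(g)\overline{\rho_\cdot}(a)\lambda_X(g)^{-1}$. The fixed ring $H_{\overline{A}}=L[\overline{A}]^{(G,\circ)}$ is a $K$-Hopf algebra acting on $L^B$ by $(\sum_a c_a\overline{\rho_\cdot}(a))[t]=\sum_a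 c_a\, a[t]$, giving a Hopf-Galois structure on $L^B/K$. A free generator of a module $M$ over a ring $R$ is an element $m$ such that $r\mapsto r[m]$ is a bijection $R\to M$. *)

(* Defs.v *)
From HB Require Import structures.
From mathcomp Require Import all_boot all_order all_algebra all_fingroup all_field.

Set Implicit Arguments.
Unset Strict Implicit.
Unset Printing Implicit Defensive.

Import GroupScope GRing.Theory.
Local Open Scope ring_scope.

Definition free_generator (R : pzRingType) (M : lmodType R) (m : M) : Prop :=
  bijective (fun r : R => r *: m).
Arguments free_generator : clear implicits.

(* A finite left skew brace (G, ·, ∘): the multiplication of the underlying
   finGroupType is ·, and cone and cinv are the identity and inverse for ∘. *)

HB.mixin Record FinGroup_isSkewBrace G of FinGroup G := {
  circ : G -> G -> G;
  cone : G;
  cinv : G -> G;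
  circA : associative circ;
  circ1x : left_id cone circ;
  circVx : left_inverse cone cinv circ;
  circ_mul : forall x y z : G,
    circ x (y * z)%g = (circ x y * x^-1 * circ x z)%g }.

#[short(type="finSkewBraceType")]
HB.structure Definition FinSkewBrace :=
  {G of FinGroup_isSkewBrace G & FinGroup G}.

Notation "x ∘ y" := (circ x y) (at level 40, left associativity) : group_scope.

(* The group (G, ∘) *)
Definition cgroup (G : finSkewBraceType) : Type := G.
HB.instance Definition _ (G : finSkewBraceType) := Finite.on (cgroup G).
HB.instance Definition _ (G : finSkewBraceType) :=
  Finite_isGroup.Build (cgroup G) (@circA G) (@circ1x G) (@circVx G).

Section SkewBrace.
Variable G : finSkewBraceType.
Local Open Scope group_scope.
Implicit Types (x y z : G) (A B : {group G}).

Lemma circgE (x y : cgroup G) : x * y = ((x : G) ∘ (y : G)) :> G.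
Proof. by []. Qed.

Lemma cinvE (x : cgroup G) : x^-1 = cinv (x : G) :> G.
Proof. by []. Qed.

Definition gamma x y : G := x^-1 * (x ∘ y).

Definition left_ideal A : Prop := forall x, gamma x @: A = A.

Definition ideal A : Prop :=
  [/\ left_ideal A, A <| [set: G]
    & (A : {set cgroup G}) <| [set: cgroup G]].

Definition semidirect A B : Prop :=
  [/\ ideal A, left_ideal B, A :&: B = 1, A * B = [set: G]
    & (A : {set cgroup G}) * (B : {set cgroup G}) = [set: cgroup G]].

Lemma cone1 : cone = 1 :> G.
Proof.
have h := @circ_mul G cone 1 1.
rewrite mulg1 !circ1x mul1g mulg1 in h.
by rewrite -[LHS]invgK -h invg1.
Qed.

Lemma cgroup1E : (1 : cgroup G) = (1 : G). Proof. exact: cone1. Qed.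

Lemma circ1g x : 1 ∘ x = x. Proof. by rewrite -cone1 circ1x. Qed.
Lemma circg1 x : x ∘ 1 = x.
Proof. by rewrite -cone1; exact: (@mulg1 (cgroup G)). Qed.
Lemma circVg x : cinv x ∘ x = 1. Proof. by rewrite circVx cone1. Qed.
Lemma circgV x : x ∘ cinv x = 1.
Proof. by rewrite -cone1; exact: (@mulgV (cgroup G)). Qed.

Lemma circE x y : x ∘ y = x * gamma x y.
Proof. by rewrite /gamma mulKVg. Qed.

Lemma gammaM x : {morph gamma x : y z / y * z}.
Proof. by move=> y z; rewrite /gamma circ_mul !mulgA. Qed.

Lemma gamma_circ x y z : gamma (x ∘ y) z = gamma x (gamma y z).
Proof.
apply: (mulgI (x ∘ y)); rewrite -circE -circA (circE y) [RHS]mulgA.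
by rewrite circ_mul -(mulgA _ x^-1).
Qed.

Lemma gamma1 x : gamma 1 x = x.
Proof. by rewrite /gamma circ1g invg1 mul1g. Qed.

Lemma gammaK x : cancel (gamma x) (gamma (cinv x)).
Proof. by move=> y; rewrite -gamma_circ circVg gamma1. Qed.
Lemma gammaVK x : cancel (gamma (cinv x)) (gamma x).
Proof. by move=> y; rewrite -gamma_circ circgV gamma1. Qed.
Lemma gamma_inj x : injective (gamma x).
Proof. exact: can_inj (gammaK x). Qed.

Lemma left_ideal_gamma A x y : left_ideal A -> y \in A -> gamma x y \in A.
Proof. by move=> lA Ay; rewrite -(lA x) imset_f. Qed.

Lemma mul_circ x y : x * y = x ∘ gamma (cinv x) y.
Proof. by rewrite circE gammaVK. Qed.

Lemma left_ideal_circ A x y :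
  left_ideal A -> x \in A -> y \in A -> x ∘ y \in A.
Proof. by move=> lA Ax Ay; rewrite circE groupM ?left_ideal_gamma. Qed.

Lemma cinvEgamma x : cinv x = gamma (cinv x) x^-1.
Proof.
apply: (@gamma_inj x); rewrite gammaVK.
by apply: (mulgI x); rewrite -circE circgV mulgV.
Qed.

Lemma left_ideal_cinv A x : left_ideal A -> x \in A -> cinv x \in A.
Proof. by move=> lA Ax; rewrite cinvEgamma left_ideal_gamma ?groupV. Qed.

Lemma left_ideal_cgroup A : left_ideal A -> group_set (A : {set cgroup G}).
Proof.
move=> lA; apply/group_setP; split=> [|x y Ax Ay].
  by rewrite cgroup1E; exact: (group1 A).
exact: left_ideal_circ.
Qed.

End SkewBrace.

(* The tensor product over K of two finite-dimensional K-spaces, as the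
   space of matrices of coordinates on the pairs of basis vectors; the
   universal property is tens_universal below. *)
Definition tens (K : fieldType) (U V : vectType K) : Type :=
  'M[K]_(\dim {:U}, \dim {:V}).

HB.instance Definition _ (K : fieldType) (U V : vectType K) :=
  Vector.copy (tens U V) 'M[K]_(\dim {:U}, \dim {:V}).

Section Tensor.
Variables (K : fieldType) (U V : vectType K).
Local Notation eU := (vbasis {:U}).
Local Notation eV := (vbasis {:V}).

Definition ptens (u : U) (v : V) : tens U V :=
  \matrix_(i, j) (coord eU i u * coord eV j v).

Definition bilin (W : lmodType K) (f : U -> V -> W) : Prop :=
  (forall u, linear (f u)) /\ (forall v, linear (f^~ v)).

(* The linear map induced by a bilinear one. *)
Definition tlift (W : lmodType K) (f : U -> V -> W) (x : tens U V) : W :=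
  \sum_i \sum_j x i j *: f eU`_i eV`_j.

Lemma lin_sum (W1 W2 : lmodType K) (g : W1 -> W2) (I : finType)
    (F : I -> W1) : linear g -> g (\sum_i F i) = \sum_i g (F i).
Proof.
move=> lg; apply: (big_rec2 (fun x y => g x = y)) => [|i x y _ <-].
  by have := lg (-1) 0 0; rewrite scaler0 addr0 scaleN1r addNr.
by have := lg 1 (F i) x; rewrite !scale1r.
Qed.

Lemma linear_sumZ (W1 W2 : lmodType K) (g : W1 -> W2) (I : finType)
    (c : I -> K) (F : I -> W1) :
  linear g -> g (\sum_i c i *: F i) = \sum_i c i *: g (F i).
Proof.
move=> lg; rewrite lin_sum //; apply: eq_bigr => i _.
have g0 : g 0 = 0 by have := lg (-1) 0 0; rewrite scaler0 addr0 scaleN1r addNr.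
by have := lg (c i) (F i) 0; rewrite g0 !addr0.
Qed.

Lemma coord_e (T : vectType K) (i j : 'I_(\dim {:T})) :
  coord (vbasis {:T}) i (vbasis {:T})`_j = (i == j)%:R.
Proof. by rewrite coord_free ?(basis_free (vbasisP _)) // eq_sym. Qed.

Lemma bilin_ptens : bilin ptens.
Proof.
split=> [u|v] a x y; apply/matrixP=> i j; rewrite !mxE linearP /=.
  by rewrite mulrDr mulrCA.
by rewrite mulrDl mulrA.
Qed.

Lemma tlift_linear (W : lmodType K) (f : U -> V -> W) : linear (tlift f).
Proof.
move=> a x y; rewrite /tlift scaler_sumr -big_split; apply: eq_bigr => i _ /=.
rewrite scaler_sumr -big_split; apply: eq_bigr => j _ /=.
by rewrite !mxE scalerDl scalerA.
Qed.

Lemma tlift_comb (W : lmodType K) (f g h : U -> V -> W) a x :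
  (forall u v, f u v = a *: g u v + h u v) ->
  tlift f x = a *: tlift g x + tlift h x.
Proof.
move=> fgh; rewrite /tlift scaler_sumr -big_split; apply: eq_bigr => i _ /=.
rewrite scaler_sumr -big_split; apply: eq_bigr => j _ /=.
by rewrite fgh scalerDr !scalerA mulrC.
Qed.

Lemma tlift_ptens (W : lmodType K) (f : U -> V -> W) u v :
  bilin f -> tlift f (ptens u v) = f u v.
Proof.
case=> f2 f1; rewrite {2}(coord_vbasis (memvf u)).
rewrite (linear_sumZ _ _ (f1 v)); apply: eq_bigr => i _.
rewrite {2}(coord_vbasis (memvf v)) (linear_sumZ _ _ (f2 _)) scaler_sumr.
by apply: eq_bigr => j _; rewrite mxE scalerA.
Qed.

Lemma tens_dec x : x = tlift ptens x.
Proof.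
apply/matrixP=> i j; rewrite summxE (bigD1 i) //= summxE (bigD1 j) //=.
rewrite !mxE !coord_e !eqxx !mulr1 !big1 ?addr0 // => k.
  move=> /negPf ki; rewrite summxE big1 // => l _.
  by rewrite !mxE !coord_e eq_sym ki mul0r mulr0.
by move=> /negPf kj; rewrite !mxE !coord_e [j == k]eq_sym kj !mulr0.
Qed.

Lemma tens_ext (W : lmodType K) (g h : tens U V -> W) :
  linear g -> linear h -> (forall u v, g (ptens u v) = h (ptens u v)) ->
  g =1 h.
Proof.
move=> lg lh gh x; rewrite (tens_dec x) /tlift.
rewrite (lin_sum _ lg) (lin_sum _ lh); apply: eq_bigr => i _.
rewrite (linear_sumZ _ _ lg) (linear_sumZ _ _ lh).
by apply: eq_bigr => j _; rewrite gh.
Qed.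

Lemma tens_universal (W : lmodType K) (f : U -> V -> W) :
  bilin f ->
  exists g : tens U V -> W,
    [/\ linear g, forall u v, g (ptens u v) = f u v
      & forall h : tens U V -> W, linear h ->
          (forall u v, h (ptens u v) = f u v) -> h =1 g].
Proof.
move=> bf; exists (tlift f); split=> [|u v|h lh hE].
- exact: tlift_linear.
- exact: tlift_ptens.
- apply: tens_ext => // [|u v]; first exact: tlift_linear.
  by rewrite hE tlift_ptens.
Qed.

End Tensor.

(* For K-algebras U and V, the product with
   (u ⊗ v) * (u' ⊗ v') = (u * u') ⊗ (v * v'), see tmul_ptens. *)
Section TensorRing.
Variables (K : fieldType) (U V : falgType K).
Local Notation T := (tens U V).
Implicit Types (x y z : T) (u : U) (v : V).

Definition tone : T := ptens 1 1.
Definition tmul x y : T :=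
  tlift (fun u v => tlift (fun u' v' => ptens (u * u') (v * v') : T) y) x.

Lemma ptensPl u : linear (fun v => ptens u v : T).
Proof. exact: (@bilin_ptens K U V).1. Qed.
Lemma ptensPr v : linear (fun u => ptens u v : T).
Proof. exact: (@bilin_ptens K U V).2. Qed.

Lemma bilin_mul u v : bilin (fun u' v' => ptens (u * u') (v * v') : T).
Proof.
split=> w a x y; rewrite mulrDr -scalerAr.
  exact: ptensPl.
exact: ptensPr (v * w) a _ _.
Qed.

Lemma tmul_linear_l y : linear (tmul^~ y).
Proof. exact: tlift_linear. Qed.

Lemma tmul_linear_r x : linear (tmul x).
Proof. by move=> a y z; apply: tlift_comb => u v; apply: tlift_linear. Qed.

Lemma tmul_bilin y :
  bilin (fun u v => tlift (fun u' v' => ptens (u * u') (v * v') : T) y).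
Proof.
split=> [u|v] a x1 x2; apply: tlift_comb => u' v'.
  by rewrite mulrDl -scalerAl ptensPl.
by rewrite mulrDl -scalerAl (ptensPr _ a).
Qed.

Lemma tmul_ptens u v u' v' :
  tmul (ptens u v) (ptens u' v') = ptens (u * u') (v * v').
Proof.
rewrite /tmul tlift_ptens; last exact: tmul_bilin.
by rewrite tlift_ptens //; apply: bilin_mul.
Qed.

Lemma tmulDl : left_distributive tmul +%R.
Proof. by move=> x y z; rewrite -[x]scale1r tmul_linear_l !scale1r. Qed.
Lemma tmulDr : right_distributive tmul +%R.
Proof. by move=> x y z; rewrite -[y]scale1r tmul_linear_r !scale1r. Qed.
Lemma tmul1 : left_id tone tmul.
Proof.
apply: tens_ext; [exact: tmul_linear_r | by [] |].
by move=> u v; rewrite tmul_ptens !mul1r.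
Qed.
Lemma tmulr1 : right_id tone tmul.
Proof.
apply: tens_ext; [exact: tmul_linear_l | by [] |].
by move=> u v; rewrite tmul_ptens !mulr1.
Qed.
Lemma tmulA : associative tmul.
Proof.
move=> x y z; move: x.
apply: tens_ext => [||u v]; first exact: tmul_linear_l.
  by move=> a x1 x2; rewrite !tmul_linear_l.
move: y; apply: tens_ext => [a y1 y2|a y1 y2|u' v'].
- by rewrite tmul_linear_l tmul_linear_r.
- by rewrite tmul_linear_r tmul_linear_l.
move: z; apply: tens_ext => [a z1 z2|a z1 z2|u2 v2].
- by rewrite !tmul_linear_r.
- by rewrite tmul_linear_r.
by rewrite !tmul_ptens !mulrA.
Qed.

End TensorRing.

HB.instance Definition _ (K : fieldType) (U V : falgType K) :=
  GRing.Zmodule_isPzRing.Build (tens U V)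
    (@tmulA K U V) (@tmul1 K U V) (@tmulr1 K U V)
    (@tmulDl K U V) (@tmulDr K U V).

(* The group algebra L[gT], viewed as a K-algebra; an element is the
   function giving its coefficients. *)
Definition galg (K : fieldType) (L : splittingFieldType K) (gT : finGroupType)
  : Type := {ffun gT -> L}.

HB.instance Definition _ K (L : splittingFieldType K) (gT : finGroupType) :=
  Vector.copy (galg L gT) {ffun gT -> L}.

Section GroupAlgebra.
Variables (K : fieldType) (L : splittingFieldType K) (gT : finGroupType).
Local Notation LG := (galg L gT).
Implicit Types (x y z : LG) (u v w : gT).

(* The monomial c u *)
Definition gmono (c : L) u : LG := [ffun v => if v == u then c else 0].
Definition galg_one : LG := gmono 1 1%g.
Definition galg_mul x y : LG := [ffun w => \sum_u x u * y (u^-1 * w)%g].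

Lemma galg_mulA : associative galg_mul.
Proof.
move=> x y z; apply/ffunP=> w; rewrite !ffunE.
under eq_bigr => u _ do rewrite ffunE mulr_sumr.
under [RHS]eq_bigr => v _ do rewrite ffunE mulr_suml.
rewrite [RHS]exchange_big; apply: eq_bigr => u _ /=.
rewrite (reindex_inj (mulgI u^-1)%g) /=; apply: eq_bigr => v _.
by rewrite mulrA invMg invgK -!mulgA mulKVg.
Qed.

Lemma galg_mul1 : left_id galg_one galg_mul.
Proof.
move=> x; apply/ffunP=> w; rewrite !ffunE (bigD1 1%g) //= big1 => [|u /negPf u1].
  by rewrite ffunE eqxx mul1r addr0 invg1 mul1g.
by rewrite ffunE u1 mul0r.
Qed.

Lemma galg_mulr1 : right_id galg_one galg_mul.
Proof.
move=> x; apply/ffunP=> w; rewrite !ffunE (bigD1 w) //= big1 => [|u /negPf u1].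
  by rewrite ffunE mulVg eqxx mulr1 addr0.
by rewrite ffunE -eq_mulVg1 u1 mulr0.
Qed.

Lemma galg_mulDl : left_distributive galg_mul +%R.
Proof.
move=> x y z; apply/ffunP=> w; rewrite !ffunE -big_split.
by apply: eq_bigr => u _; rewrite ffunE mulrDl.
Qed.

Lemma galg_mulDr : right_distributive galg_mul +%R.
Proof.
move=> x y z; apply/ffunP=> w; rewrite !ffunE -big_split.
by apply: eq_bigr => u _; rewrite ffunE mulrDr.
Qed.

Lemma galg_one_neq0 : galg_one != 0.
Proof.
by apply/eqP=> /ffunP/(_ 1%g)/eqP; rewrite !ffunE eqxx oner_eq0.
Qed.

End GroupAlgebra.

HB.instance Definition _ K (L : splittingFieldType K) (gT : finGroupType) :=
  GRing.Zmodule_isNzRing.Build (galg L gT)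
    (@galg_mulA K L gT) (@galg_mul1 K L gT) (@galg_mulr1 K L gT)
    (@galg_mulDl K L gT) (@galg_mulDr K L gT) (@galg_one_neq0 K L gT).

Section GroupAlgebraK.
Variables (K : fieldType) (L : splittingFieldType K) (gT : finGroupType).
Local Notation LG := (galg L gT).
Implicit Types (x y : LG) (k : K).

Lemma galg_scaleAl k x y : k *: (x * y) = (k *: x) * y.
Proof.
apply/ffunP=> w; rewrite !ffunE scaler_sumr.
by apply: eq_bigr => u _; rewrite ffunE scalerAl.
Qed.

Lemma galg_scaleAr k x y : k *: (x * y) = x * (k *: y).
Proof.
apply/ffunP=> w; rewrite !ffunE scaler_sumr.
by apply: eq_bigr => u _; rewrite ffunE scalerAr.
Qed.

End GroupAlgebraK.

HB.instance Definition _ K (L : splittingFieldType K) (gT : finGroupType) :=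
  GRing.Lmodule_isLalgebra.Build K (galg L gT) (@galg_scaleAl K L gT).
HB.instance Definition _ K (L : splittingFieldType K) (gT : finGroupType) :=
  GRing.Lalgebra_isAlgebra.Build K (galg L gT) (@galg_scaleAr K L gT).
HB.instance Definition _ K (L : splittingFieldType K) (gT : finGroupType) :=
  Algebra_isFalgebra.Build K (galg L gT).

(* An identification of (G, ∘) with the Galois group of L / K, so that
   (x ∘ y)[t] = x[y[t]]. (The library's product on gal_of composes the other
   way round: (x * y) t = y (x t).) *)
Record galois_iso (K : fieldType) (L : splittingFieldType K)
    (G : finSkewBraceType) := GaloisIso {
  gact :> G -> gal_of {:L};
  gact_bij : bijective gact;
  gact_circ : forall (x y : G) (t : L), gact (x ∘ y)%g t = gact x (gact y t) }.

Section Descent.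
Variables (K : fieldType) (L : splittingFieldType K) (G : finSkewBraceType).
Variables (s : galois_iso L G) (gT : finGroupType) (f : G -> gT -> gT).
Local Notation LG := (galg L gT).
Implicit Types (x y : LG) (S : {set gT}).

(* g ⋆ (\sum_u c_u u) = \sum_u g(c_u) f_g(u) *)
Definition star (g : G) (x : LG) : LG := \sum_u gmono (s g (x u)) (f g u).

Definition supp_restr (S : {set gT}) (x : LG) : LG :=
  [ffun u => if u \in S then 0 else x u].

(* L[S], and its fixed points under (G, ∘) *)
Definition galg_supp (S : {set gT}) : {vspace LG} :=
  lker (linfun (supp_restr S)).
Definition galg_fix (S : {set gT}) : {vspace LG} :=
  (galg_supp S :&: \bigcap_(g : G) fixedSpace (linfun (star g)))%VS.

Lemma supp_restr_linear S : linear (supp_restr S).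
Proof.
move=> a x y; apply/ffunP=> u; rewrite !ffunE.
by case: ifP => _; rewrite ?scaler0 ?addr0 // !ffunE.
Qed.
HB.instance Definition _ S :=
  GRing.isLinear.Build K LG LG _ (supp_restr S) (supp_restr_linear S).

Lemma star_linear g : linear (star g).
Proof.
move=> a x y; rewrite /star scaler_sumr -big_split; apply: eq_bigr => u _.
apply/ffunP=> v; rewrite !ffunE linearP /=.
by case: ifP => _; rewrite ?scaler0 ?addr0.
Qed.
HB.instance Definition _ g :=
  GRing.isLinear.Build K LG LG _ (star g) (star_linear g).

Lemma galg_suppP S x :
  reflect (forall u, u \notin S -> x u = 0) (x \in galg_supp S).
Proof.
rewrite memv_ker lfunE; apply: (iffP eqP) => [/ffunP x0 u uS|x0].
  by have := x0 u; rewrite !ffunE (negPf uS).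
by apply/ffunP=> u; rewrite !ffunE; case: ifPn => // /x0.
Qed.

Lemma galg_fixP S x :
  reflect ((forall u, u \notin S -> x u = 0) /\ (forall g, star g x = x))
          (x \in galg_fix S).
Proof.
have -> : (x \in galg_fix S) =
    (x \in galg_supp S) && [forall g, star g x == x].
  rewrite /galg_fix memv_cap; congr (_ && _).
  rewrite memvE; apply/subv_bigcapP/forallP => h g.
    by have := h g isT; rewrite -memvE => /fixedSpaceP; rewrite lfunE => /eqP.
  move=> _; rewrite -memvE; apply/fixedSpaceP; rewrite lfunE; exact: (eqP (h g)).
apply: (iffP andP) => [[/galg_suppP x0 /forallP fx]|[x0 fx]]; split=> //.
- by move=> g; apply/eqP.
- exact/galg_suppP.
- by apply/forallP=> g; apply/eqP.
Qed.

Hypothesis fI : forall g, injective (f g).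
Hypothesis fM : forall g, {morph f g : u v / (u * v)%g}.

Lemma starE g x u : star g x (f g u) = s g (x u).
Proof.
rewrite /star sum_ffunE (bigD1 u) //= big1 => [|v /negPf vu].
  by rewrite ffunE eqxx addr0.
by rewrite ffunE (inj_eq (@fI g)) eq_sym vu.
Qed.

Lemma star_eq g x y :
  (forall u, s g (x u) = y (f g u)) -> star g x = y.
Proof.
move=> h; apply/ffunP=> u.
by rewrite -(f_invF (@fI g) u) starE h.
Qed.

Lemma star_mul g x y : star g (x * y) = star g x * star g y.
Proof.
apply: star_eq => u; rewrite !ffunE rmorph_sum [RHS](reindex_inj (@fI g)) /=.
apply: eq_bigr => v _; rewrite starE.
have -> : ((f g v)^-1 * f g u)%g = f g (v^-1 * u)%g.
  by apply: (mulgI (f g v)); rewrite mulKVg -fM mulKVg.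
by rewrite starE; apply: rmorphM.
Qed.

Lemma star_one g : star g 1 = 1.
Proof.
apply: star_eq => u; rewrite !ffunE.
have f1 : f g 1%g = 1%g by apply: (mulgI (f g 1%g)); rewrite -fM !mulg1.
by rewrite -(inj_eq (@fI g)) f1; case: ifP => _; rewrite ?rmorph1 ?rmorph0.
Qed.

Lemma galg_fix1 S : group_set S -> 1 \in galg_fix S.
Proof.
move=> /group_setP[S1 _]; apply/galg_fixP; split=> [u uS|g]; last exact: star_one.
by rewrite ffunE; case: eqP uS => // ->; rewrite S1.
Qed.

Lemma galg_fixM S x y :
  group_set S -> x \in galg_fix S -> y \in galg_fix S -> x * y \in galg_fix S.
Proof.
move=> gS /galg_fixP[x0 fx] /galg_fixP[y0 fy].
apply/galg_fixP; split=> [u uS|g]; last by rewrite star_mul fx fy.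
rewrite ffunE big1 // => v _.
have [vS|/x0 ->] := boolP (v \in S); last by rewrite mul0r.
rewrite y0 ?mulr0 //; apply: contra uS => uS.
by rewrite -(mulKVg v u); have /group_setP[_ ->] := gS.
Qed.

Lemma galg_fix_aspace S : group_set S -> is_aspace (galg_fix S).
Proof.
move=> gS; rewrite /is_aspace has_algid1 ?galg_fix1 //=.
by apply/prodvP => x y xS yS; apply: galg_fixM.
Qed.

End Descent.

Section BraceAction.
Variables (K : fieldType) (L : splittingFieldType K) (G : finSkewBraceType).
Variable s : galois_iso L G.
Implicit Types (A B : {group G}) (h : galg L G) (t : L) (x y : G).

(* H_A = L[A, ·]^(G, ∘), for A a subgroup of (G, ·) *)
Definition hopf A : {aspace galg L G} :=
  ASpace (galg_fix_aspace s (@gamma_inj G) (@gammaM G) (groupP A)).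

(* The fixed field of a subset of (G, ∘) *)
Definition Lfix (S : {set G}) : {aspace L} := fixedField_aspace (s @: S).

Definition gapply h t : L := \sum_y h y * s y t.

Lemma LfixP (S : {set G}) t :
  reflect (forall x, x \in S -> s x t = t) (t \in Lfix S).
Proof.
apply: (iffP (fixedFieldP (memvf t))) => ht x Sx; first exact/ht/imset_f.
by case/imsetP: Sx => y Sy ->; apply: ht.
Qed.

Lemma gapply_linear_l t : linear (gapply^~ t).
Proof.
move=> a h h'; rewrite /gapply scaler_sumr -big_split; apply: eq_bigr => y _.
by rewrite !ffunE mulrDl scalerAl.
Qed.

Lemma gapply_linear_r h : linear (gapply h).
Proof.
move=> a t t'; rewrite /gapply scaler_sumr -big_split; apply: eq_bigr => y _.
by rewrite linearP mulrDr scalerAr.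
Qed.

Lemma gapplyDl t : {morph gapply^~ t : h h' / h + h'}.
Proof. by move=> h h'; rewrite -[h]scale1r gapply_linear_l !scale1r. Qed.
Lemma gapplyDr h : {morph gapply h : t t' / t + t'}.
Proof. by move=> t t'; rewrite -[t]scale1r gapply_linear_r !scale1r. Qed.

Lemma gact_sum x t h :
  s x (gapply h t) = \sum_y s x (h y) * s (x ∘ y)%g t.
Proof.
rewrite linear_sum; apply: eq_bigr => y _ /=.
by rewrite gact_circ; apply: rmorphM.
Qed.

Lemma gapply_mul A h h' t : h' \in hopf A ->
  gapply (h * h') t = gapply h (gapply h' t).
Proof.
case/galg_fixP=> _ fh'; rewrite /gapply.
under eq_bigr => w _ do rewrite ffunE mulr_suml.
rewrite exchange_big; apply: eq_bigr => x _ /=.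
rewrite -/(gapply h' t) gact_sum mulr_sumr (reindex_inj (mulgI x)) /=.
rewrite (reindex_inj (@gamma_inj G x)) /=; apply: eq_bigr => y _.
by rewrite mulKg -circE -(starE s (@gamma_inj G)) fh' mulrA.
Qed.

Lemma gact1 t : s 1%g t = t.
Proof.
have h := gact_circ s 1%g 1%g t; rewrite circ1g in h.
by apply: (fmorph_inj (s 1%g)).
Qed.

Lemma gapply1 t : gapply 1 t = t.
Proof.
rewrite /gapply (bigD1 1%g) //= big1 => [|y /negPf y1].
  by rewrite ffunE eqxx mul1r addr0 gact1.
by rewrite ffunE y1 mul0r.
Qed.

Lemma gapply_fixl A h c t :
  h \in hopf A -> c \in Lfix A -> gapply h (c * t) = c * gapply h t.
Proof.
case/galg_fixP=> h0 _ /LfixP fc; rewrite /gapply mulr_sumr.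
apply: eq_bigr => y _; have [yA|/h0 ->] := boolP (y \in A); last first.
  by rewrite !mul0r mulr0.
by rewrite mulrCA -[in RHS](fc y yA); congr (_ * _); apply: rmorphM.
Qed.

Lemma gapply_stab A B h t :
  ideal A -> h \in hopf B -> t \in Lfix A -> gapply h t \in Lfix A.
Proof.
case=> lA nA _ /galg_fixP[_ fh] /LfixP ft; apply/LfixP=> a Aa.
rewrite gact_sum [RHS](reindex_inj (@gamma_inj G a)) /=.
apply: eq_bigr => y _; rewrite -(starE s (@gamma_inj G)) fh; congr (_ * _).
rewrite circE; set v := gamma a y.
rewrite (conjgC a v) mul_circ gact_circ ft // left_ideal_gamma //.
by rewrite memJ_norm // (subsetP (normal_norm nA)) ?inE.
Qed.

End BraceAction.

(* L as an H_G-module *)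
Definition L_hopf (K : fieldType) (L : splittingFieldType K)
  (G : finSkewBraceType) (s : galois_iso L G) : Type := L.

Section LHopf.
Variables (K : fieldType) (L : splittingFieldType K) (G : finSkewBraceType).
Variable s : galois_iso L G.
Local Notation H := (subvs_of (hopf s [set: G]%G)).
HB.instance Definition _ := GRing.Zmodule.copy (L_hopf s) L.

Definition L_hopf_scale (h : H) (t : L_hopf s) : L_hopf s :=
  gapply s (vsval h) t.

Lemma hopf_one A : vsval (1 : subvs_of (hopf s A)) = 1.
Proof.
apply/eqP; rewrite [_ == _]algid_eq1; apply: galg_fix1 (groupP A).
  exact: gamma_inj.
exact: gammaM.
Qed.

Lemma L_hopf_scaleA h h' t :
  L_hopf_scale h (L_hopf_scale h' t) = L_hopf_scale (h * h') t.
Proof. by rewrite /L_hopf_scale -(gapply_mul _ _ (subvsP h')). Qed.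
Lemma L_hopf_scale1 : left_id 1 L_hopf_scale.
Proof. by move=> t; rewrite /L_hopf_scale hopf_one gapply1. Qed.
Lemma L_hopf_scaleDr : right_distributive L_hopf_scale +%R.
Proof. by move=> h t t'; apply: gapplyDr. Qed.
Lemma L_hopf_scaleDl t : {morph L_hopf_scale^~ t : h h' / h + h'}.
Proof. by move=> h h'; apply: gapplyDl. Qed.

HB.instance Definition _ := GRing.Zmodule_isLmodule.Build H (L_hopf s)
  L_hopf_scaleA L_hopf_scale1 L_hopf_scaleDr L_hopf_scaleDl.
End LHopf.

(* L as a module over the tensor product of L^A and H_A *)
Definition L_tens (K : fieldType) (L : splittingFieldType K)
  (G : finSkewBraceType) (s : galois_iso L G) (A : {group G}) : Type := L.

Section LTens.
Variables (K : fieldType) (L : splittingFieldType K) (G : finSkewBraceType).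
Variables (s : galois_iso L G) (A : {group G}).
Local Notation LA := (subvs_of (Lfix s A)).
Local Notation HA := (subvs_of (hopf s A)).
Local Notation T := (tens LA HA).
HB.instance Definition _ := GRing.Zmodule.copy (L_tens s A) L.

Definition L_tens_scale (x : T) (t : L_tens s A) : L_tens s A :=
  tlift (fun (c : LA) (w : HA) => vsval c * gapply s (vsval w) t) x.

Lemma L_tens_bilin t :
  bilin (fun (c : LA) (w : HA) => vsval c * gapply s (vsval w) t).
Proof.
split=> [c|w] a x y.
  by rewrite linearP /= gapply_linear_l mulrDr scalerAr.
by rewrite linearP /= mulrDl scalerAl.
Qed.

Lemma L_tens_scale_linear_l t : linear (L_tens_scale^~ t).
Proof. exact: tlift_linear. Qed.

Lemma L_tens_scale_linear_r x : linear (L_tens_scale x : L -> L).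
Proof.
move=> a t t'; apply: tlift_comb => c w.
by rewrite gapply_linear_r mulrDr scalerAr.
Qed.

Lemma L_tens_scale_ptens c w t :
  L_tens_scale (ptens c w) t = vsval c * gapply s (vsval w) t.
Proof. by rewrite /L_tens_scale tlift_ptens //; apply: L_tens_bilin. Qed.

Lemma L_tens_scaleA x y t :
  L_tens_scale x (L_tens_scale y t) = L_tens_scale (x * y) t.
Proof.
move: x; apply: (@tens_ext _ _ _ L) => [a x x'|a x x'|c w].
- exact: L_tens_scale_linear_l.
- rewrite [X in L_tens_scale X _](tmul_linear_l y).
  exact: L_tens_scale_linear_l.
move: y; apply: (@tens_ext _ _ _ L) => [a y y'|a y y'|c' w'].
- by rewrite L_tens_scale_linear_l L_tens_scale_linear_r.
- rewrite [X in L_tens_scale X _](tmul_linear_r (ptens c w)).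
  exact: L_tens_scale_linear_l.
rewrite [ptens c w * _]tmul_ptens !L_tens_scale_ptens.
rewrite (gapply_fixl _ (subvsP w) (subvsP c')) mulrA.
by rewrite -(gapply_mul _ _ (subvsP w')).
Qed.

Lemma L_tens_scale1 : left_id 1 L_tens_scale.
Proof.
move=> t; rewrite [1 in LHS]/(ptens 1 1) L_tens_scale_ptens hopf_one gapply1.
by rewrite /= algid1 mul1r.
Qed.

Lemma L_tens_scaleDr : right_distributive L_tens_scale +%R.
Proof.
move=> x t t'; rewrite -[t in LHS](scale1r (t : L)).
by rewrite L_tens_scale_linear_r scale1r.
Qed.

Lemma L_tens_scaleDl t : {morph L_tens_scale^~ t : x y / x + y}.
Proof.
by move=> x y; rewrite -[x in LHS]scale1r L_tens_scale_linear_l scale1r.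
Qed.

HB.instance Definition _ := GRing.Zmodule_isLmodule.Build T (L_tens s A)
  L_tens_scaleA L_tens_scale1 L_tens_scaleDr L_tens_scaleDl.
End LTens.

(* L^A as an H_B-module *)
Definition LA_hopf (K : fieldType) (L : splittingFieldType K)
    (G : finSkewBraceType) (s : galois_iso L G) (A B : {group G})
    (sd : semidirect A B) : Type :=
  subvs_of (Lfix s A).

Section LAHopf.
Variables (K : fieldType) (L : splittingFieldType K) (G : finSkewBraceType).
Variables (s : galois_iso L G) (A B : {group G}) (sd : semidirect A B).
Local Notation HB := (subvs_of (hopf s B)).
Local Notation M := (LA_hopf s sd).
HB.instance Definition _ := GRing.Zmodule.copy M (subvs_of (Lfix s A)).

Lemma semidirect_ideal : ideal A. Proof. by case: sd. Qed.

Definition LA_hopf_scale (h : HB) (t : M) : M :=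
  Subvs (gapply_stab semidirect_ideal (subvsP h) (subvsP t)).

Lemma LA_hopf_scaleA h h' t :
  LA_hopf_scale h (LA_hopf_scale h' t) = LA_hopf_scale (h * h') t.
Proof. by apply/val_inj; rewrite /= -(gapply_mul _ _ (subvsP h')). Qed.
Lemma LA_hopf_scale1 : left_id 1 LA_hopf_scale.
Proof.
move=> t; apply/val_inj.
by change (gapply s (vsval (1 : HB)) (vsval t) = vsval t); rewrite hopf_one gapply1.
Qed.
Lemma LA_hopf_scaleDr : right_distributive LA_hopf_scale +%R.
Proof. by move=> h t t'; apply/val_inj/gapplyDr. Qed.
Lemma LA_hopf_scaleDl t : {morph LA_hopf_scale^~ t : h h' / h + h'}.
Proof. by move=> h h'; apply/val_inj/gapplyDl. Qed.

HB.instance Definition _ := GRing.Zmodule_isLmodule.Build HB M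
  LA_hopf_scaleA LA_hopf_scale1 LA_hopf_scaleDr LA_hopf_scaleDl.
End LAHopf.

(* Perm(T) with the product (p * q) x = p (q x); the library's product on
   {perm T} composes the other way round. *)
Definition cperm (T : finType) : Type := {perm T}.
HB.instance Definition _ (T : finType) := Finite.on (cperm T).
Section CPerm.
Variable T : finType.
Local Open Scope group_scope.
Definition cperm_mul (p q : {perm T}) : {perm T} := q * p.
Lemma cperm_mulA : associative cperm_mul.
Proof. by move=> p q r; rewrite /cperm_mul mulgA. Qed.
Lemma cperm_mul1 : left_id 1 cperm_mul.
Proof. by move=> p; rewrite /cperm_mul mulg1. Qed.
Lemma cperm_mulV : left_inverse 1 invg cperm_mul.
Proof. by move=> p; rewrite /cperm_mul mulgV. Qed.
End CPerm.
HB.instance Definition _ (T : finType) :=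
  Finite_isGroup.Build (cperm T) (@cperm_mulA T) (@cperm_mul1 T) (@cperm_mulV T).

(* X = G / B, the left cosets of (B, ∘) in (G, ∘) *)
Definition cosetX (G : finSkewBraceType) (B : {group G}) : finType :=
  {xB : {set cgroup G} |
    xB \in lcosets (B : {set cgroup G}) [set: cgroup G]}.

Section CosetSpace.
Variables (G : finSkewBraceType) (B : {group G}).
Local Open Scope group_scope.
Local Notation X := (cosetX B).
Local Notation BC := (B : {set cgroup G}).
Implicit Types (x y g : G) (p q : cperm X).

Lemma lcos_in (g : G) : lcoset BC g \in lcosets BC [set: cgroup G].
Proof. by apply: imset_f; rewrite inE. Qed.
(* x ∘ B *)
Definition lcosX g : X := exist _ (lcoset BC g) (lcos_in g).

Lemma lcosX_surj (c : X) : exists g, c = lcosX g.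
Proof.
case: (c) (valP c) => Y /= hY _; case/imsetP: (hY) => g _ Yg.
by exists g; apply/val_inj.
Qed.

Lemma lam_in (g : G) (c : X) :
  lcoset (val c) g \in lcosets BC [set: cgroup G].
Proof.
case: (lcosX_surj c) => h -> /=.
have -> : lcoset (lcoset BC h) g = lcoset BC (g ∘ h) by rewrite !lcosetE -lcosetM.
exact: lcos_in.
Qed.
Definition lamX_fun g (c : X) : X := exist _ (lcoset (val c) g) (lam_in g c).
Lemma lamX_inj g : injective (lamX_fun g).
Proof.
move=> c d /(congr1 val) /= h; apply/val_inj.
by apply: (can_inj (@lcosetK (cgroup G) g)); rewrite !lcosetE in h *.
Qed.
Definition lamX g : cperm X := perm (@lamX_inj g).

End CosetSpace.

(* The permutation sending a' ∘ B to (a' · a^-1) ∘ B for all a' in A;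
   it exists and is unique by rhoXE and sd_rep. *)
HB.lock Definition rhoX (G : finSkewBraceType) (A B : {group G}) (a : G) :
    cperm (cosetX B) :=
  odflt 1%g [pick p : {perm cosetX B} |
    [forall a' in A, p (lcosX B a') == lcosX B (a' * a^-1)%g]].

Section SemidirectCosets.
Variables (G : finSkewBraceType) (A B : {group G}).
Local Open Scope group_scope.
Local Notation X := (cosetX B).
Local Notation BC := (B : {set cgroup G}).
Local Notation lcosX := (lcosX B).
Local Notation lamX := (lamX B).
Local Notation rhoX := (rhoX A B).
Implicit Types (x y g : G) (p q : cperm X).

Definition Abar : {set cperm X} := rhoX @: A.

Definition lam_conj g p : cperm X := lamX g * p * (lamX g)^-1.

Lemma lamXE g x : (lamX g : {perm X}) (lcosX x) = lcosX (g ∘ x).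
Proof.
rewrite permE; apply/val_inj => /=.
by rewrite !lcosetE -lcosetM.
Qed.

Lemma cpermM p q c :
  ((p * q)%g : {perm X}) c = (p : {perm X}) ((q : {perm X}) c).
Proof. exact: permM. Qed.

Lemma lam_conj_inj g : injective (lam_conj g).
Proof. by move=> p q /mulIg/mulgI. Qed.
Lemma lam_conjM g : {morph lam_conj g : p q / p * q}.
Proof. by move=> p q; rewrite /lam_conj !mulgA mulgKV. Qed.

Hypothesis sd : semidirect A B.

Let lA : left_ideal A. Proof. by case: sd => -[]. Qed.
Let lB : left_ideal B. Proof. by case: sd. Qed.
Let BG : {group cgroup G} := Group (left_ideal_cgroup lB).

Lemma sd_cdec x : exists a b, [/\ a \in A, b \in B & x = a ∘ b].
Proof.
case: sd => _ _ _ _ /setP/(_ x); rewrite inE => /mulsgP[a b Aa Bb ->].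
by exists a, b.
Qed.

Lemma sd_triv x : x \in A -> x \in B -> x = 1.
Proof.
by move=> Ax Bx; case: sd => _ _ /setP/(_ x); rewrite !inE Ax Bx => /esym/eqP.
Qed.

Lemma lcosX_circ x b : b \in B -> lcosX (x ∘ b) = lcosX x.
Proof.
move=> Bb; apply/val_inj => /=; rewrite !lcosetE.
rewrite (lcosetM _ (x : cgroup G) (b : cgroup G)).
by rewrite [in LHS](@lcoset_id _ BG).
Qed.

Lemma sd_rep (c : X) : exists2 a, a \in A & c = lcosX a.
Proof.
case: (lcosX_surj c) => g ->; case: (sd_cdec g) => a [b [Aa Bb ->]].
by exists a => //; rewrite lcosX_circ.
Qed.

Lemma lcosX_inj a a' : a \in A -> a' \in A -> lcosX a = lcosX a' -> a = a'.
Proof.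
move=> Aa Aa' /(congr1 val) /= h.
have : (a : cgroup G) \in lcoset BC a'.
  by rewrite -h lcosetE; apply: (@lcoset_refl _ BG).
rewrite lcosetE mem_lcoset => Bc.
have /sd_triv : (cinv a' ∘ a) \in A.
  by apply: left_ideal_circ => //; apply: left_ideal_cinv.
move=> /(_ Bc) /(congr1 (circ a')).
by rewrite circA circgV circ1g circg1.
Qed.

Lemma rhoXE a a' : a \in A -> a' \in A ->
  (rhoX a : {perm X}) (lcosX a') = lcosX (a' * a^-1).
Proof.
move=> Aa Aa'; rewrite rhoX.unlock; case: pickP => [p /forall_inP/(_ _ Aa')/eqP //|].
pose rp c := odflt 1 [pick x in A | lcosX x == c].
have rpE x : x \in A -> rp (lcosX x) = x.
  move=> Ax; rewrite /rp; case: pickP => [y /andP[Ay /eqP/lcosX_inj]|/(_ x)].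
    by move=> ->.
  by rewrite Ax eqxx.
pose F c := lcosX (rp c * a^-1).
have FI : injective F.
  move=> c d; case: (sd_rep c) => x Ax ->; case: (sd_rep d) => y Ay ->.
  rewrite /F !rpE // => /lcosX_inj h; congr lcosX.
  by apply: (mulIg a^-1); apply: h; rewrite groupM ?groupV.
move=> /(_ (perm FI)) /negP[]; apply/forall_inP=> x Ax.
by rewrite permE /F rpE.
Qed.

Lemma cperm_ext p q :
  (forall a, a \in A -> (p : {perm X}) (lcosX a) = (q : {perm X}) (lcosX a)) ->
  p = q.
Proof. by move=> pq; apply/permP=> c; case: (sd_rep c) => a Aa ->; apply: pq. Qed.

Lemma rhoXM : {in A &, {morph rhoX : a b / a * b}}.
Proof.
move=> a b Aa Ab; apply: cperm_ext => c Ac.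
have Acb : c * b^-1 \in A by rewrite groupM ?groupV.
rewrite [RHS]cpermM.
rewrite (rhoXE (groupM Aa Ab) Ac).
rewrite (rhoXE Ab Ac).
rewrite (rhoXE Aa Acb).
by rewrite invMg mulgA.
Qed.

Lemma rhoX_inj : {in A &, injective rhoX}.
Proof.
move=> a b Aa Ab /(congr1 (fun p : {perm X} => p (lcosX 1))).
rewrite !rhoXE // !mul1g => /lcosX_inj h; apply: invg_inj.
by apply: h; rewrite groupV.
Qed.

Lemma rhoX1 : rhoX 1 = 1.
Proof. by apply: (mulgI (rhoX 1)); rewrite -rhoXM // !mulg1. Qed.

Lemma Abar_group : group_set Abar.
Proof.
apply/group_setP; split=> [|_ _ /imsetP[a Aa ->] /imsetP[b Ab ->]].
  by rewrite -rhoX1 imset_f.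
by rewrite -rhoXM // imset_f ?groupM.
Qed.

Lemma cinvK x y : cinv x ∘ (x ∘ y) = y.
Proof. by rewrite circA circVg circ1g. Qed.

Lemma circ_conjA x a : a \in A -> x ∘ a ∘ cinv x \in A.
Proof.
move=> Aa; case: sd => -[_ _ /normal_norm/subsetP/(_ (cinv x : cgroup G))].
rewrite inE => /(_ isT) nx _ _ _ _.
have := memJ_norm (a : cgroup G) nx; rewrite /conjg -cinvE invgK mulgA => h.
by have := h; rewrite Aa.
Qed.

(* For b in B, conjugation by b in (G, ∘) is an automorphism of (A, ·). *)
Lemma circ_conjE b a : b \in B -> a \in A ->
  b ∘ a ∘ cinv b = b * gamma b a * b^-1.
Proof.
move=> Bb Aa; set x := b * _ * _.
have nA : A <| [set: G] by case: sd => -[].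
have Ax : x \in A.
  have := memJ_norm (gamma b a) (subsetP (normal_norm nA) b^-1 _).
  by rewrite inE => /(_ isT); rewrite /conjg invgK mulgA left_ideal_gamma.
have e : b ∘ a = x ∘ gamma (cinv x) b by rewrite -mul_circ mulgKV circE.
have := circ_conjA b Aa; rewrite e => h.
suff /eqP : gamma (cinv x) b ∘ cinv b = 1.
  by move/eqP => h1; rewrite -circA h1 circg1.
apply: sd_triv; last first.
  by rewrite left_ideal_circ ?left_ideal_gamma ?left_ideal_cinv.
rewrite -(cinvK x (gamma (cinv x) b ∘ cinv b)) (circA x).
by rewrite left_ideal_circ ?left_ideal_cinv.
Qed.

Lemma lam_conjA x a : x \in A -> a \in A -> lam_conj x (rhoX a) = rhoX (gamma x a).
Proof.
move=> Ax Aa; apply: (mulIg (lamX x)); rewrite /lam_conj mulgKV.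
apply: cperm_ext => c Ac.
rewrite !cpermM lamXE !rhoXE ?left_ideal_gamma ?left_ideal_circ //.
rewrite lamXE circ_mul -mulgA -/(gamma x _); congr (lcosX (_ * _)).
apply: (mulIg (gamma x a)); rewrite mulVg -gammaM mulVg.
by rewrite /gamma circg1 mulVg.
Qed.

Lemma lam_conjB b a : b \in B -> a \in A ->
  lam_conj b (rhoX a) = rhoX (b ∘ a ∘ cinv b).
Proof.
move=> Bb Aa; apply: (mulIg (lamX b)); rewrite /lam_conj mulgKV.
apply: cperm_ext => c Ac.
rewrite !cpermM lamXE rhoXE // lamXE.
have Bb' : cinv b \in B by exact: left_ideal_cinv.
rewrite -(lcosX_circ (b ∘ c) Bb') rhoXE ?circ_conjA //.
rewrite -(lcosX_circ (b ∘ _) Bb'); congr lcosX.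
rewrite !circ_conjE ?groupM ?groupV // gammaM.
have -> : gamma b a^-1 = (gamma b a)^-1.
  apply: (mulIg (gamma b a)); rewrite mulVg -gammaM mulVg.
  by rewrite /gamma circg1 mulVg.
by rewrite !invMg invgK !mulgA mulgKV.
Qed.

End SemidirectCosets.

(* H_Abar = L[Abar]^(G, ∘), acting on L^B *)
Section BarAction.
Variables (K : fieldType) (L : splittingFieldType K) (G : finSkewBraceType).
Variables (s : galois_iso L G) (A B : {group G}) (sd : semidirect A B).
Local Notation X := (cosetX B).
Local Notation LP := (galg L (cperm X)).
Local Notation rho := (rhoX A B).
Implicit Types (h : LP) (t : L) (x y : G).

Definition hopf_bar : {aspace LP} :=
  ASpace (galg_fix_aspace s (@lam_conj_inj G B) (@lam_conjM G B)
            (Abar_group sd)).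

Definition bapply (h : LP) (t : L) : L := \sum_(a in A) h (rho a) * s a t.

Lemma bapplyDl t : {morph bapply^~ t : h h' / h + h'}.
Proof.
move=> h h'; rewrite /bapply -big_split; apply: eq_bigr => a _.
by rewrite ffunE mulrDl.
Qed.

Lemma bapplyDr h : {morph bapply h : t t' / t + t'}.
Proof.
move=> t t'; rewrite /bapply -big_split; apply: eq_bigr => a _.
by rewrite rmorphD mulrDr.
Qed.

Lemma hopf_barP h : h \in hopf_bar ->
  (forall p, p \notin Abar A B -> h p = 0) /\
  (forall g a, a \in A -> s g (h (rho a)) = h (lam_conj g (rho a))).
Proof.
case/galg_fixP=> h0 fh; split=> // g a Aa.
by rewrite -(starE s (@lam_conj_inj G B)) fh.
Qed.

Let lA : left_ideal A. Proof. by case: sd => -[]. Qed.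

Lemma reindex_in (f : G -> G) (F : G -> L) :
  {in A &, injective f} -> {in A, forall a, f a \in A} ->
  \sum_(a in A) F a = \sum_(a in A) F (f a).
Proof.
move=> fI fA; have /eqP fAA : f @: A == A.
  rewrite eqEcard card_in_imset // leqnn andbT.
  by apply/subsetP=> _ /imsetP[a Aa ->]; apply: fA.
by rewrite -{1}fAA big_imset.
Qed.

Lemma bapply_mul h h' t : h \in hopf_bar -> h' \in hopf_bar ->
  bapply (h * h') t = bapply h (bapply h' t).
Proof.
move=> /hopf_barP[h0 _] /hopf_barP[_ fh'].
have mulE w : w \in A ->
    (h * h') (rho w) = \sum_(a in A) h (rho a) * h' (rho (a^-1 * w)%g).
  move=> Aw; rewrite ffunE (bigID (mem (Abar A B))) /= addrC big1 => [|p /h0 ->].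
    rewrite add0r big_imset /=; last exact: rhoX_inj.
    apply: eq_bigr => a Aa; congr (_ * h' _).
    by apply: (mulgI (rho a)); rewrite mulKVg -(rhoXM sd) ?mulKVg ?groupM ?groupV.
  by rewrite mul0r.
rewrite /bapply.
under eq_bigr => w Aw do rewrite mulE // mulr_suml.
rewrite exchange_big; apply: eq_bigr => a Aa /=.
rewrite linear_sum mulr_sumr (reindex_in (f := fun w => a * w)%g); first last.
- by move=> w Aw; rewrite groupM.
- by move=> w w' _ _ /mulgI.
rewrite (reindex_in (f := gamma a)); first last.
- by move=> w Aw; rewrite left_ideal_gamma.
- by move=> w w' _ _ /gamma_inj.
apply: eq_bigr => w Aw; rewrite mulKg -circE gact_circ -mulrA; congr (_ * _).
rewrite -(lam_conjA sd) // -fh' //; symmetry; exact: rmorphM.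
Qed.

Lemma bapply1 t : bapply 1 t = t.
Proof.
rewrite /bapply (bigD1 1%g) //= big1 => [|a /andP[Aa /negPf a1]].
  by rewrite (rhoX1 sd) ffunE eqxx mul1r addr0 gact1.
rewrite ffunE; case: eqP => [ra|]; last by rewrite mul0r.
move/eqP: a1; case; apply: (rhoX_inj sd) => //.
by rewrite ra (rhoX1 sd).
Qed.

Lemma bapply_stab h t :
  h \in hopf_bar -> t \in Lfix s B -> bapply h t \in Lfix s B.
Proof.
move=> /hopf_barP[_ fh] /LfixP ft; apply/LfixP=> b Bb.
pose f a := (b ∘ a ∘ cinv b)%g.
rewrite linear_sum [RHS](reindex_in (f := f)); first last.
- by move=> a Aa; apply: (circ_conjA sd).
- move=> a a' _ _ /(congr1 (fun x => x ∘ b)%g).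
  rewrite /f -!circA !circVg !circg1.
  by move=> /(congr1 (circ (cinv b))); rewrite !cinvK.
apply: eq_bigr => a Aa; rewrite /f -(lam_conjB sd) // -fh //.
have -> : s (b ∘ a ∘ cinv b)%g t = s b (s a t).
  rewrite -gact_circ -[in RHS](circg1 (b ∘ a)%g) -(circVg b) circA.
  by rewrite [in RHS]gact_circ (ft b Bb).
exact: rmorphM.
Qed.

Lemma hopf_bar_one : vsval (1 : subvs_of hopf_bar) = 1.
Proof.
apply/eqP; rewrite [_ == _]algid_eq1; apply: galg_fix1 (Abar_group sd).
  exact: lam_conj_inj.
exact: lam_conjM.
Qed.

End BarAction.

(* L^B as an H_Abar-module *)
Definition LB_hopf_bar (K : fieldType) (L : splittingFieldType K)
    (G : finSkewBraceType) (s : galois_iso L G) (A B : {group G})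
    (sd : semidirect A B) : Type :=
  subvs_of (Lfix s B).

Section LBHopfBar.
Variables (K : fieldType) (L : splittingFieldType K) (G : finSkewBraceType).
Variables (s : galois_iso L G) (A B : {group G}) (sd : semidirect A B).
Local Notation H := (subvs_of (hopf_bar s sd)).
Local Notation M := (LB_hopf_bar s sd).
HB.instance Definition _ := GRing.Zmodule.copy M (subvs_of (Lfix s B)).

Definition LB_hopf_bar_scale (h : H) (t : M) : M :=
  Subvs (bapply_stab (subvsP h) (subvsP t)).

Lemma LB_hopf_bar_scaleA h h' t :
  LB_hopf_bar_scale h (LB_hopf_bar_scale h' t) = LB_hopf_bar_scale (h * h') t.
Proof.
by apply/val_inj; rewrite /= -(bapply_mul _ (subvsP h) (subvsP h')).
Qed.
Lemma LB_hopf_bar_scale1 : left_id 1 LB_hopf_bar_scale.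
Proof.
move=> t; apply/val_inj.
change (bapply s A (vsval (1 : H)) (vsval t) = vsval t).
by rewrite hopf_bar_one (bapply1 s sd).
Qed.
Lemma LB_hopf_bar_scaleDr : right_distributive LB_hopf_bar_scale +%R.
Proof. by move=> h t t'; apply/val_inj/bapplyDr. Qed.
Lemma LB_hopf_bar_scaleDl t : {morph LB_hopf_bar_scale^~ t : h h' / h + h'}.
Proof. by move=> h h'; apply/val_inj/bapplyDl. Qed.

HB.instance Definition _ := GRing.Zmodule_isLmodule.Build H M
  LB_hopf_bar_scaleA LB_hopf_bar_scale1
  LB_hopf_bar_scaleDr LB_hopf_bar_scaleDl.
End LBHopfBar.

Section Actions.
Variables (K : fieldType) (L : splittingFieldType K) (G : finSkewBraceType).
Variables (s : galois_iso L G) (A B : {group G}) (sd : semidirect A B).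

Lemma L_hopfE (h : subvs_of (hopf s [set: G]%G)) (t : L_hopf s) :
  h *: t = \sum_y vsval h y * s y t.
Proof. by []. Qed.

Lemma LA_hopfE (h : subvs_of (hopf s B)) (t : LA_hopf s sd) :
  vsval (h *: t) = \sum_y vsval h y * s y (vsval t).
Proof. by []. Qed.

Lemma LB_hopf_barE (h : subvs_of (hopf_bar s sd)) (t : LB_hopf_bar s sd) :
  vsval (h *: t) = \sum_(a in A) vsval h (rhoX A B a) * s a (vsval t).
Proof. by []. Qed.

Lemma L_tensE (c : subvs_of (Lfix s A)) (w : subvs_of (hopf s A))
    (t : L_tens s A) :
  ptens c w *: t = vsval c * \sum_y vsval w y * s y t.
Proof. exact: L_tens_scale_ptens. Qed.

End Actions.

(* Main.v *)
Require Import Defs.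
From HB Require Import structures.
From mathcomp Require Import all_boot all_order all_algebra all_fingroup all_field.

Set Implicit Arguments.
Unset Strict Implicit.
Unset Printing Implicit Defensive.

Import GRing.Theory.
Local Open Scope ring_scope.

(* For a left ideal S, an element t is annihilated by no nonzero element of
   H_S = L[S]^G if and only if the L-linear system \sum_y k_y (x . y)[t] = 0,
   x in G, has only the zero solution k in L[S]: the solution space is stable
   under the semilinear action of G, so by Galois descent a nonzero solution
   yields a nonzero fixed one. The same holds for the action of H_Abar on L^B.
   Write x = a b and y = a' b' with a, a' in A and b, b' in B, all in (G, ·).
   Then x y = (a * b a' b^-1) * (b b'), so (x y)[alpha beta] is the product of
   (b b')[alpha] and (a * b a' b^-1)[beta]: up to a permutation of its columns
   depending on b, the system for alpha beta is the tensor product of the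
   systems for alpha and beta. This gives injectivity in (2). In (1), an
   element of L^A (x) H_A killing beta gives a solution in L[A] of the system
   for beta, hence it vanishes, because a K-basis of H_A is free over L.
   Surjectivity follows by counting dimensions, from dim_K H_S >= |S|. *)

(** * Bijectivity of linear maps by counting dimensions *)

Lemma inj_linear_bij (K : fieldType) (U V : vectType K) (g : U -> V) :
  linear g -> (forall x, g x = 0 -> x = 0) -> (\dim {:V} <= \dim {:U})%N ->
  bijective g.
Proof.
move=> lg g0 dVU.
pose gl : {linear U -> V} := HB.pack g (GRing.isLinear.Build K U V _ g lg).
have ker0 : lker (linfun gl) == 0%VS.
  rewrite -subv0; apply/subvP=> x; rewrite memv_ker lfunE memv0 => /eqP gx.
  by apply/eqP/g0.
have im : limg (linfun gl) = {:V}%VS.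
  apply/eqP; rewrite eqEdim subvf limg_dim_eq //.
  by rewrite (eqP ker0) capv0.
exists (linfun gl)^-1%VF => x.
  by rewrite -[RHS](lker0_lfunK ker0 x) lfunE.
transitivity (linfun gl ((linfun gl)^-1%VF x)); first by rewrite lfunE.
by rewrite limg_lfunVK // im memvf.
Qed.

(** * Galois descent for [L]-valued functions on a finite [G]-set *)

Section GaloisDescent.
Variables (K : fieldType) (L : splittingFieldType K) (G : finSkewBraceType).
Variable s : galois_iso L G.
Implicit Types (x y g : G) (c : L).

(** Dedekind's independence of automorphisms, transported along the bijection [s]. *)
Lemma gact_independent (d : G -> L) :
  (forall c, \sum_g d g * s g c = 0) -> forall g, d g = 0.
Proof.
case: (gact_bij s) => s' sK s'K d0 g.
rewrite -[g]sK; apply: (@gal_independent _ _ _ predT (d \o s')) => //= a _.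
rewrite (reindex s) /=; last by exists s' => x _; [apply: sK | apply: s'K].
by rewrite -[RHS](d0 a); apply: eq_bigr => x _; rewrite sK.
Qed.

Lemma cinv_circ x y : cinv (x ∘ y)%g = (cinv y ∘ cinv x)%g.
Proof. exact: (@invMg (cgroup G)). Qed.

Lemma cinv1 : cinv 1%g = 1%g :> G.
Proof. by rewrite -[LHS]circ1g circgV. Qed.

Variables (I : finType) (f : G -> I -> I).
Hypothesis f1 : forall u, f 1%g u = u.
Hypothesis f_circ : forall x y u, f (x ∘ y)%g u = f x (f y u).
Implicit Type k : {ffun I -> L}.

(** The inverse makes this a left semilinear action of [(G, ∘)]; its fixed points are the [k] with
    [k (f g u) = s g (k u)]. *)
Definition twist g k : {ffun I -> L} := [ffun u => s g (k (f (cinv g) u))].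

Definition twist_trace k : {ffun I -> L} := \sum_g twist g k.

Lemma circ_actK g : cancel (f g) (f (cinv g)).
Proof. by move=> u; rewrite -f_circ circVg f1. Qed.

Lemma twist_circ x y k : twist (x ∘ y)%g k = twist x (twist y k).
Proof. by apply/ffunP=> u; rewrite !ffunE cinv_circ f_circ gact_circ. Qed.

Lemma twist_trace_fix k g u : twist_trace k (f g u) = s g (twist_trace k u).
Proof.
rewrite !sum_ffunE rmorph_sum /= (reindex_inj (@mulgI (cgroup G) g)) /=.
apply: eq_bigr => x _; rewrite !ffunE -gact_circ -f_circ.
by rewrite [_ x]circgE cinv_circ -circA circVg circg1.
Qed.

(** For [k] in [V], the trace of each multiple [c k] is a fixed element of [V], hence zero. At [u]
    this is a linear relation between the [s g c], valid for all [c], so its coefficients vanish;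
    the one at [g = 1] is [k u]. *)
Lemma galois_descent (V : {ffun I -> L} -> Prop) :
  (forall k k', V k -> V k' -> V (k + k')) ->
  (forall c k, V k -> V [ffun u => c * k u]) ->
  (forall g k, V k -> V (twist g k)) ->
  (forall k, V k -> (forall g u, k (f g u) = s g (k u)) -> k = 0) ->
  forall k, V k -> k = 0.
Proof.
move=> VD VZ Vs V0 k Vk; apply/ffunP=> u; rewrite ffunE.
have VT k' : V k' -> V (twist_trace k').
  move=> Vk'; apply: (big_ind V) => [||g _]; [|exact: VD | exact: Vs].
  have := VZ 0 _ Vk; congr V; apply/ffunP=> v; by rewrite !ffunE mul0r.
have tr0 c : \sum_g s g (k (f (cinv g) u)) * s g c = 0.
  have /ffunP/(_ u) := V0 _ (VT _ (VZ c _ Vk)) (twist_trace_fix _).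
  rewrite sum_ffunE ffunE => {2}<-; apply: eq_bigr => g _.
  by rewrite !ffunE mulrC; symmetry; apply: rmorphM.
by have := gact_independent tr0 1%g; rewrite cinv1 f1 (Defs.gact1 s).
Qed.

End GaloisDescent.

(** * Fixed rings of left ideals: annihilators, dimensions, freeness over [L] *)

Lemma left_ideal_setT (G : finSkewBraceType) : left_ideal [set: G].
Proof.
by move=> x; apply/setP=> y; rewrite inE -(gammaVK x y) imset_f ?inE.
Qed.

Section FixedRings.
Variables (K : fieldType) (L : splittingFieldType K) (G : finSkewBraceType).
Variable s : galois_iso L G.
Implicit Types (x y g : G) (c t : L) (A B : {group G}).

Lemma star_twist (gT : finGroupType) (f : G -> gT -> gT) :
    (forall u, f 1%g u = u) ->
    (forall x y u, f (x ∘ y)%g u = f x (f y u)) ->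
  forall g (k : galg L gT), star s f g k = twist s f g k.
Proof.
move=> f1 f_circ g k; apply: star_eq => [g' | u]; last first.
  by rewrite ffunE -f_circ circVg f1.
exact: can_inj (circ_actK f1 f_circ g').
Qed.

Lemma hopfP A (k : galg L G) :
  reflect ((forall u, u \notin A -> k u = 0) /\
           (forall g u, k (gamma g u) = s g (k u)))
          (k \in hopf s A).
Proof.
apply: (iffP (galg_fixP _ _ _ _)) => -[k0 fk]; split=> // g.
  by move=> u; rewrite -(starE s (@gamma_inj G)) fk.
by apply: star_eq => [|u]; [apply: gamma_inj | rewrite fk].
Qed.

Section LeftIdeal.
Variable A : {group G}.
Hypothesis lA : left_ideal A.

Lemma left_ideal_gammaE g u : (gamma g u \in A) = (u \in A).
Proof.
apply/idP/idP => Au; last exact: left_ideal_gamma.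
by rewrite -(gammaK g u) left_ideal_gamma.
Qed.

(** Invariance gives [s x (k y) = k (gamma x y)], and [x ∘ y = x * gamma x y]. Hence an annihilator
    of [t] solves every equation of the system. *)
Lemma gact_gapply k t x : k \in hopf s A ->
  s x (gapply s k t) = \sum_y k y * s (x * y)%g t.
Proof.
case/hopfP=> _ fk; rewrite gact_sum [RHS](reindex_inj (@gamma_inj G x)) /=.
by apply: eq_bigr => y _; rewrite fk circE.
Qed.

Lemma gapply_nonsingular t :
    (forall h, h \in hopf s A -> gapply s h t = 0 -> h = 0) ->
  forall k : {ffun G -> L}, (forall u, u \notin A -> k u = 0) ->
    (forall x, \sum_y k y * s (x * y)%g t = 0) -> k = 0.
Proof.
move=> inj k k0 kt.
pose V (k : {ffun G -> L}) := (forall u, u \notin A -> k u = 0) /\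
    (forall x, \sum_y k y * s (x * y)%g t = 0).
apply: (@galois_descent _ _ _ s _ (@gamma G) (@gamma1 G) (@gamma_circ G) V)
  => //.
- move=> h h' [h0 ht] [h0' ht']; split=> [u uA | x].
    by rewrite ffunE h0 ?h0' ?addr0.
  under eq_bigr => y _ do rewrite ffunE mulrDl.
  by rewrite big_split /= ht ht' addr0.
- move=> c h [h0 ht]; split=> [u uA | x]; first by rewrite ffunE h0 ?mulr0.
  rewrite -[RHS](mulr0 c) -[in RHS](ht x) mulr_sumr; apply: eq_bigr => y _.
  by rewrite ffunE mulrA.
- move=> g h [h0 ht]; split=> [u uA | x].
    by rewrite ffunE h0 ?rmorph0 ?left_ideal_gammaE.
  (* Equation [x] for the twisted function is [g] applied to equation [cinv g ∘ x] for [h]. *)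
  rewrite -[RHS](rmorph0 (s g)) -[in RHS](ht (cinv g ∘ x)%g) rmorph_sum /=.
  rewrite (reindex_inj (@gamma_inj G g)) /=; apply: eq_bigr => y _.
  rewrite ffunE gammaK.
  have -> : (x * gamma g y)%g = (g ∘ ((cinv g ∘ x) * y))%g.
    by rewrite circ_mul circA circgV circ1g /gamma mulgA.
  by rewrite gact_circ; symmetry; apply: rmorphM.
move=> h [h0 ht] fh; apply: inj; first by apply/hopfP.
by rewrite -[RHS](ht 1%g); apply: eq_bigr => y _; rewrite mul1g.
Qed.

(* [phi] is a linear form on [L[A]]; it is evaluated on the traces of the
   monomials [c u]. *)
Lemma hopf_dual_eq0 (phi : G -> L) :
    (forall h, h \in hopf s A -> \sum_(u in A) phi u * h u = 0) ->
  forall u, u \in A -> phi u = 0.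
Proof.
move=> phi0 u Au; rewrite -[u]gamma1.
apply: (gact_independent (s := s) (d := fun g => phi (gamma g u))) => c.
pose h := twist_trace s (@gamma G) (gmono c u).
have hH : h \in hopf s A.
  apply/hopfP; split=> [v vA | g v]; last first.
    exact: (twist_trace_fix s (@gamma_circ G)).
  rewrite sum_ffunE big1 // => g _; rewrite !ffunE; case: eqP => [e|].
    by rewrite -(left_ideal_gammaE (cinv g)) e Au in vA.
  by rewrite rmorph0.
rewrite -[RHS](phi0 h hH) /=.
under [RHS]eq_bigr => v _ do rewrite sum_ffunE mulr_sumr.
rewrite exchange_big /=; apply: eq_bigr => g _.
rewrite (bigD1 (gamma g u)) ?left_ideal_gamma //= big1 ?addr0.
  by rewrite !ffunE gammaK eqxx.
move=> v /andP[_ vu]; rewrite !ffunE; case: eqP => [e|]; last first.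
  by rewrite rmorph0 mulr0.
by rewrite -e gammaVK eqxx in vu.
Qed.

(** A relation between the rows of [M] is a linear form on [L[A]] vanishing on [H_A], so it is zero
    by [hopf_dual_eq0]. *)
Lemma leq_card_dim_hopf : (#|A| <= \dim (hopf s A))%N.
Proof.
pose w := vbasis (hopf s A).
pose M : 'M[L]_(#|A|, \dim (hopf s A)) :=
  \matrix_(i, j) (w`_j : galg L G) (enum_val i).
suff /eqP <- : row_free M by apply: rank_leq_col.
apply: inj_row_free => v vM.
have /= v0 : forall u, u \in A -> v 0 (enum_rank_in (group1 A) u) = 0.
  apply: (hopf_dual_eq0 (phi := fun u => v 0 (enum_rank_in (group1 A) u))) => h.
  move/coord_vbasis => ->.
  transitivity (\sum_j coord w j h *: (v *m M) 0 j); last first.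
    by apply: big1 => j _; rewrite vM mxE scaler0.
  under eq_bigr => u _ do rewrite sum_ffunE mulr_sumr.
  rewrite exchange_big /=; apply: eq_bigr => j _.
  rewrite mxE scaler_sumr big_enum_val /=; apply: eq_bigr => i _.
  by rewrite mxE enum_valK_in ffunE scalerAr.
apply/rowP=> i; rewrite mxE -(v0 (enum_val i)) ?enum_valP //.
by rewrite enum_valK_in.
Qed.

Lemma dim_Lfix : \dim {:L} = (#|A| * \dim (Lfix s A))%N.
Proof.
have gS : group_set (s @: A).
  apply/group_setP; split=> [|_ _ /imsetP[a Aa ->] /imsetP[b Ab ->]].
    apply/imsetP; exists 1%g; rewrite ?group1 //.
    apply/eqP/gal_eqP => t _; rewrite gal_id.
    by symmetry; apply: (Defs.gact1 s t).
  (* The product of [gal_of] composes in the opposite order. *)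
  apply/imsetP; exists (b ∘ a)%g; first exact: left_ideal_circ.
  by apply/eqP/gal_eqP=> t _; rewrite galM ?memvf // gact_circ.
rewrite -(card_imset A (bij_inj (gact_bij s))).
rewrite (dim_fixedField (Group gS)).
exact: dim_sup_field (subvf (Lfix s A)).
Qed.

End LeftIdeal.

Hypothesis galLK : galois 1 {:L}.

Lemma Lfix_all t : (forall g, s g t = t) -> t \in (1 : {subfield L})%VS.
Proof.
move=> ft; have /galois_fixedField <- := galLK.
apply/fixedFieldP=> [|x _]; first exact: memvf.
by case: (gact_bij s) => s' _ s'K; rewrite -(s'K x) ft.
Qed.

(** The [L]-relations are stable under the Galois action on their coefficients, and a fixed relation
    has coefficients in [K]. Descent applies with the trivial action on the indices. *)
Lemma fixed_family_free (I : finType) (n : nat) (w : 'I_n -> {ffun I -> L})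
    (f : G -> I -> I) :
    (forall g, injective (f g)) ->
    (forall j g u, w j (f g u) = s g (w j u)) ->
    (forall a : 'I_n -> K, \sum_j a j *: w j = 0 -> forall j, a j = 0) ->
  forall c : 'I_n -> L, (forall u, \sum_j c j * w j u = 0) ->
    forall j, c j = 0.
Proof.
move=> fI fw freew c cw j.
pose V (k : {ffun 'I_n -> L}) := forall u, \sum_j k j * w j u = 0.
suff /ffunP/(_ j) : [ffun j => c j] = 0 by rewrite !ffunE.
apply: (@galois_descent _ _ _ s _ (fun _ => id) _ _ V) => //.
- move=> k k' kw kw' u; under eq_bigr => i _ do rewrite ffunE mulrDl.
  by rewrite big_split /= kw kw' addr0.
- move=> b k kw u; rewrite -[RHS](mulr0 b) -[in RHS](kw u) mulr_sumr.
  by apply: eq_bigr => i _; rewrite ffunE mulrA.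
- move=> g k kw u; rewrite -[u](f_invF (fI g)).
  rewrite -[RHS](rmorph0 (s g)) -[in RHS](kw (invF (fI g) u)) rmorph_sum.
  apply: eq_bigr => i _; rewrite ffunE fw; symmetry; exact: rmorphM.
- move=> k kw fk.
  have k1 i : exists a : K, k i == a%:A.
    have /vlineP[a ->] : k i \in (1 : {subfield L})%VS.
      by apply: Lfix_all => g; rewrite -fk.
    by exists a.
  pose a i := xchoose (k1 i); have aE i : k i = a i *: 1.
    exact/eqP/(xchooseP (k1 i)).
  apply/ffunP=> i; rewrite aE (freew a) ?scale0r ?ffunE //.
  apply/ffunP=> u; rewrite sum_ffunE ffunE -[RHS](kw u); apply: eq_bigr => l _.
  by rewrite ffunE aE -scalerAl mul1r.
by move=> u; rewrite -[RHS](cw u); apply: eq_bigr => i _; rewrite ffunE.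
Qed.

End FixedRings.

(** * Semidirect products: conjugation on [Abar] and factorisation *)

Section Semidirect.
Variables (G : finSkewBraceType) (A B : {group G}).
Local Open Scope group_scope.
Implicit Types (x y g a b u : G).

Lemma lamX_circ x y : lamX B (x ∘ y) = lamX B x * lamX B y.
Proof.
apply/permP=> c; rewrite [RHS]cpermM; case: (lcosX_surj c) => g ->.
by rewrite !lamXE circA.
Qed.

Lemma lamX1 : lamX B 1 = 1.
Proof. by apply: (mulgI (lamX B 1)); rewrite -lamX_circ circ1g mulg1. Qed.

Lemma lam_conj1 (p : cperm (cosetX B)) : lam_conj 1 p = p.
Proof. by rewrite /lam_conj lamX1 mul1g invg1 mulg1. Qed.

Lemma lam_conj_circ x y (p : cperm (cosetX B)) :
  lam_conj (x ∘ y) p = lam_conj x (lam_conj y p).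
Proof. by rewrite /lam_conj lamX_circ invMg !mulgA. Qed.

Hypothesis sd : semidirect A B.

Let lA : left_ideal A. Proof. by case: sd => -[]. Qed.
Lemma semidirect_conj u x : u \in A -> u ^ x \in A.
Proof.
case: sd => -[_ nAG _] _ _ _ _ Au.
by rewrite memJ_norm // (subsetP (normal_norm nAG)) ?inE.
Qed.

Lemma lam_conj_Abar g p : (lam_conj g p \in Abar A B) = (p \in Abar A B).
Proof.
suff im x q : q \in Abar A B -> lam_conj x q \in Abar A B.
  apply/idP/idP => [/(im (cinv g))|]; last exact: im.
  by rewrite -lam_conj_circ circVg lam_conj1.
case/imsetP=> u Au ->; case: (sd_cdec sd x) => a [b [Aa Bb ->]].
have Ab := circ_conjA sd b Au.
rewrite lam_conj_circ (lam_conjB sd) // (lam_conjA sd) //.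
by apply/imset_f/left_ideal_gamma.
Qed.

(* By [circ_conjE] this map is [gamma b] followed by conjugation by [b] in
   [(G, ·)]. *)
Lemma circ_conjM b : b \in B ->
  {in A &, {morph (fun u => b ∘ u ∘ cinv b) : u v / u * v}}.
Proof.
move=> Bb u v Au Av /=; rewrite !(circ_conjE sd) ?groupM // gammaM.
by rewrite !mulgA mulgKV.
Qed.

Lemma circ_conj_inj b : injective (fun u => b ∘ u ∘ cinv b).
Proof.
move=> u v /(congr1 (fun x => cinv b ∘ (x ∘ b))).
by rewrite -!circA !circVg !circg1 !cinvK.
Qed.

(** The factorisation [a * b] is unique: [a'^-1 * a = b' * b^-1] lies in both [A] and [B]. *)
Lemma sum_semidirect (V : nmodType) (F : G -> V) :
  (\sum_y F y = \sum_(a in A) \sum_(b in B) F (a * b)%g)%R.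
Proof.
pose h (p : G * G) := p.1 * p.2.
have hI : {in setX A B &, injective h}.
  move=> [a b] [a' b'] /setXP[/= Aa Bb] /setXP[/= Aa' Bb'] e.
  have e1 : a'^-1 * a = b' * b^-1.
    by apply: (mulgI a'); rewrite mulKVg mulgA -[a' * b']e mulgK.
  have /(sd_triv sd) : a'^-1 * a \in A by rewrite groupM ?groupV.
  rewrite {1}e1 groupM ?groupV // => /(_ isT) e2.
  have ea : a = a' by rewrite -(mulKVg a' a) e2 mulg1.
  by move: e2; rewrite e1 -ea => /(canRL (mulgKV b)); rewrite mul1g => ->.
have hT : h @: setX A B = [set: G].
  case: sd => _ _ _ <- _; apply/setP=> x; apply/imsetP/mulsgP.
    by case=> -[a b] /setXP[Aa Bb] ->; exists a b.
  by case=> a b Aa Bb ->; exists (a, b); rewrite ?inE ?Aa.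
transitivity (\sum_(y in h @: setX A B) F y)%R.
  by apply: eq_bigl => y; rewrite hT inE.
rewrite big_imset // pair_big; apply: eq_bigl => -[a b]; exact: in_setX.
Qed.

End Semidirect.

(** * The systems for [alpha] and [beta], and injectivity of both actions *)

Section FixedFields.
Variables (K : fieldType) (L : splittingFieldType K) (G : finSkewBraceType).
Variables (s : galois_iso L G) (A B : {group G}) (sd : semidirect A B).
Implicit Types (x y g a b u : G) (t : L).

Let lA : left_ideal A. Proof. by case: sd => -[]. Qed.
Let lB : left_ideal B. Proof. by case: sd. Qed.
Lemma Lfix_mulr (S : {group G}) t x u : left_ideal S -> t \in Lfix s S ->
  u \in S -> s (x * u)%g t = s x t.
Proof.
move=> lS /LfixP ft Su.
by rewrite mul_circ gact_circ ft ?left_ideal_gamma.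
Qed.

(** Normality of [A] in [(G, ·)] moves [a] to the right of [x]. *)
Lemma Lfix_mull t x a : t \in Lfix s A -> a \in A -> s (a * x)%g t = s x t.
Proof.
by move=> ft Aa; rewrite conjgC (Lfix_mulr _ lA) ?(semidirect_conj sd).
Qed.

(** Descent is applied on [Perm(X)], where [(G, ∘)] acts by [lam_conj], after moving [k] from [A] to
    [Abar]. *)
Lemma bapply_nonsingular t : t \in Lfix s B ->
    (forall h, h \in hopf_bar s sd -> bapply s A h t = 0 -> h = 0) ->
  forall k : G -> L,
    (forall a, a \in A -> \sum_(u in A) k u * s (a * u)%g t = 0) ->
  forall u, u \in A -> k u = 0.
Proof.
move=> ft inj k kt u Au.
pose V (k : {ffun cperm (cosetX B) -> L}) :=
  (forall p, p \notin Abar A B -> k p = 0) /\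
  (forall a, a \in A -> \sum_(u in A) k (rhoX A B u) * s (a * u)%g t = 0).
(* The sum has at most one term, [rhoX] being injective on [A]. *)
pose kX : {ffun cperm (cosetX B) -> L} :=
  [ffun p => \sum_(v in A | rhoX A B v == p) k v].
have kXE v : v \in A -> kX (rhoX A B v) = k v.
  move=> Av; rewrite ffunE (bigD1 v) /= ?Av ?eqxx // big1 ?addr0 // => w.
  by case/andP=> /andP[Aw /eqP/(rhoX_inj sd)->] //; rewrite eqxx.
rewrite -kXE //; suff -> : kX = 0 by rewrite ffunE.
apply: (@galois_descent _ _ _ s _ (@lam_conj G B) (@lam_conj1 G B)
          (@lam_conj_circ G B) V).
- move=> h h' [h0 ht] [h0' ht']; split=> [p pA | a Aa].
    by rewrite ffunE h0 ?h0' ?addr0.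
  under eq_bigr => v _ do rewrite ffunE mulrDl.
  by rewrite big_split /= ht ?ht' ?addr0.
- move=> c h [h0 ht]; split=> [p pA | a Aa]; first by rewrite ffunE h0 ?mulr0.
  rewrite -[RHS](mulr0 c) -[in RHS](ht a) // mulr_sumr; apply: eq_bigr => v _.
  by rewrite ffunE mulrA.
(* The twist by [x ∘ b] is done in two stages, since on [A] the factor [b] acts by [∘]-conjugation
   and [x] by [gamma x]. *)
- move=> g h1; case: (sd_cdec sd g) => x [b [Ax Bb ->]] [h10 h1t].
  rewrite (twist_circ s (@lam_conj_circ G B)); set h := twist s _ b h1.
  have [h0 ht] : V h.
    split=> [p pA | a Aa].
      by rewrite ffunE h10 ?rmorph0 ?(lam_conj_Abar sd).
    have Bb' := left_ideal_cinv lB Bb.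
    (* Chosen so that [a * (b ∘ v ∘ cinv b) = b ∘ (a0 * v) ∘ cinv b], where the last factor fixes
       [t]. *)
    pose a0 := (cinv b ∘ a ∘ b)%g.
    have Aa0 : a0 \in A.
      have := circ_conjA sd (cinv b) Aa.
      by rewrite (_ : cinv (cinv b) = b) //; apply: (@invgK (cgroup G)).
    rewrite -[RHS](rmorph0 (s b)) -[in RHS](h1t a0) // rmorph_sum.
    rewrite (reindex_in _ (f := fun v => (b ∘ v ∘ cinv b)%g)); first last.
    - by move=> v Av; apply: (circ_conjA sd).
    - by move=> v w _ _; apply: circ_conj_inj.
    apply: eq_bigr => v Av; rewrite ffunE -(lam_conjB sd) //.
    rewrite -lam_conj_circ circVg lam_conj1.
    have -> : (a * (b ∘ v ∘ cinv b) = b ∘ (a0 * v) ∘ cinv b)%g.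
      rewrite (circ_conjM sd) //; congr (_ * _)%g.
      by rewrite /a0 !circA circgV circ1g -circA circgV circg1.
    rewrite !gact_circ (_ : s (cinv b) t = t); last exact: (LfixP _ _ _ ft).
    symmetry; exact: rmorphM.
  split=> [p pA | a Aa]; first by rewrite ffunE h0 ?rmorph0 ?(lam_conj_Abar sd).
  have Ax' := left_ideal_cinv lA Ax.
  have Aa0 : (cinv x ∘ a)%g \in A by apply: left_ideal_circ.
  rewrite -[RHS](rmorph0 (s x)) -[in RHS](ht _ Aa0) // rmorph_sum.
  rewrite (reindex_in _ (f := gamma x)); first last.
  - by move=> v Av; apply: left_ideal_gamma.
  - by move=> v w _ _; apply: gamma_inj.
  apply: eq_bigr => v Av; rewrite ffunE -(lam_conjA sd) //.
  rewrite -lam_conj_circ circVg lam_conj1.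
  have -> : (a * gamma x v = x ∘ ((cinv x ∘ a) * v))%g.
    by rewrite circ_mul circA circgV circ1g /gamma mulgA.
  by rewrite gact_circ; symmetry; apply: rmorphM.
- move=> h [h0 ht] fh; apply: inj.
    apply/galg_fixP; split=> // g; apply: star_eq => [|p].
      exact: lam_conj_inj.
    by rewrite fh.
  by rewrite -[RHS](ht 1%g) //; apply: eq_bigr => v _; rewrite mul1g.
split=> [p pA | a Aa].
  rewrite ffunE big1 // => v /andP[Av /eqP e].
  by rewrite -e imset_f in pA.
by rewrite -[RHS](kt a Aa); apply: eq_bigr => v Av; rewrite kXE.
Qed.

Variables alpha beta : L.
Hypothesis alphaA : alpha \in Lfix s A.
Hypothesis betaB : beta \in Lfix s B.
Hypothesis alpha_inj :
  forall h, h \in hopf s B -> gapply s h alpha = 0 -> h = 0.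
Hypothesis beta_inj :
  forall h, h \in hopf_bar s sd -> bapply s A h beta = 0 -> h = 0.

(* In [(G, ·)], [a b a' b' = (a * (b a' b^-1)) * (b b')]; its image acts on
   [alpha] as [b b'] and on [beta] as [a * (b a' b^-1)]. *)
Lemma gapply_mul_inj h :
  h \in hopf s [set: G]%G -> gapply s h (alpha * beta) = 0 -> h = 0.
Proof.
move=> hG hab.
have rel a b : a \in A -> b \in B ->
    \sum_(u in A)
       (\sum_(b' in B) h (u ^ b * b')%g * s (b * b')%g alpha) *
       s (a * u)%g beta = 0.
  move=> Aa Bb.
  have := gact_gapply (alpha * beta) (a * b)%g hG.
  rewrite hab rmorph0 (sum_semidirect sd) => /esym.
  (* This makes [a * b * (u ^ b * b')] equal to [a * u * (b * b')], which separates the two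
     actions. *)
  rewrite (reindex_in _ (f := fun u => (u ^ b)%g)); first last.
  - by move=> u Au; apply: (semidirect_conj sd).
  - by move=> u v _ _; apply: conjg_inj.
  move=> e; rewrite -[RHS]e; apply: eq_bigr => u Au; rewrite mulr_suml.
  apply: eq_bigr => b' Bb'; rewrite -mulrA; congr (_ * _).
  have -> : (a * b * (u ^ b * b') = a * u * (b * b'))%g.
    by rewrite !mulgA -(mulgA a u b) (conjgC u b) !mulgA.
  pose y := (a * u * (b * b'))%g.
  transitivity (s y alpha * s y beta); last by symmetry; apply: rmorphM.
  by rewrite /y (Lfix_mull _ alphaA (groupM Aa Au)) 
    (Lfix_mulr (a * u)%g lB betaB (groupM Bb Bb')).
(* For fixed [b], the inner sums of [rel] solve the system for [beta] in the unknowns indexed by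
   [u], so they vanish. *)
have rel' u b : u \in A -> b \in B ->
    \sum_(b' in B) h (u * b')%g * s (b * b')%g alpha = 0.
  move=> Au Bb.
  have := bapply_nonsingular betaB beta_inj (fun a Aa => rel a b Aa Bb).
  by move/(_ _ (semidirect_conj sd b^-1%g Au)); rewrite conjgKV.
have h0 u b : u \in A -> b \in B -> h (u * b)%g = 0.
  move=> Au Bb; pose k : {ffun G -> L} :=
    [ffun v => if v \in B then h (u * v)%g else 0].
  suff /ffunP/(_ b) : k = 0 by rewrite !ffunE Bb.
  apply: (gapply_nonsingular lB alpha_inj) => [v /negPf vB | x].
    by rewrite ffunE vB.
  (* The factor [a] of [x] does not affect the equation because [alpha] lies in [L^A], leaving
     [rel'] at [d]. *)
  have [a [d [Aa Bd ->]]] : exists a d, [/\ a \in A, d \in B & x = (a * d)%g].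
    case: sd => _ _ _ /setP/(_ x); rewrite inE => /mulsgP[a d Aa Bd ->] _.
    by exists a, d.
  rewrite -[RHS](rel' u d Au Bd) [RHS]big_mkcond; apply: eq_bigr => v _.
  rewrite ffunE -mulgA (Lfix_mull (d * v)%g alphaA Aa).
  by case: (v \in B); rewrite ?mul0r.
apply/ffunP=> x; rewrite ffunE.
case: sd => _ _ _ /setP/(_ x); rewrite inE => /mulsgP[a d Aa Bd ->] _.
exact: h0.
Qed.

Hypothesis galLK : galois 1 {:L}.

Lemma L_tens_scale_inj (x : tens (subvs_of (Lfix s A)) (subvs_of (hopf s A))) :
  L_tens_scale x beta = 0 -> x = 0.
Proof.
move=> xb.
pose e := vbasis {: subvs_of (Lfix s A)}.
pose w := vbasis {: subvs_of (hopf s A)}.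
(* Collecting terms along the basis [w] of [H_A] writes [x] as the sum of the [c j ⊗ w_j]. *)
pose c j : L := \sum_i x i j *: vsval e`_i.
have cA j : c j \in Lfix s A by apply: memv_suml => i _; rewrite memvZ ?subvsP.
pose W j : {ffun G -> L} := vsval w`_j.
have WH j : (W j : galg L G) \in hopf s A by apply: subvsP.
pose k u := \sum_j c j * W j u.
have k0 u : k u = 0.
  have [Au | uA] := boolP (u \in A); last first.
    rewrite /k big1 // => j _.
    by case: (hopfP _ _ _ (WH j)) => ->; rewrite ?mulr0.
  apply: (bapply_nonsingular betaB beta_inj (k := k)) => {u Au} // a Aa.
  rewrite -[RHS](rmorph0 (s a)) -[in RHS]xb /L_tens_scale /tlift exchange_big.
  have -> : \sum_j \sum_i x i j *: (vsval e`_i * gapply s (vsval w`_j) beta) =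
            \sum_j c j * gapply s (vsval w`_j) beta.
    apply: eq_bigr => j _; rewrite mulr_suml.
    by apply: eq_bigr => i _; rewrite scalerAl.
  rewrite rmorph_sum /= /k.
  under eq_bigr => u _ do rewrite mulr_suml.
  rewrite exchange_big; apply: eq_bigr => j _ /=.
  transitivity (s a (c j) * s a (gapply s (W j) beta)); last first.
    by symmetry; apply: rmorphM.
  (* As [a] fixes [c j], applying [a] to the relation [xb] gives equation [a] of the system for
     [k]. *)
  rewrite (LfixP _ _ _ (cA j) a Aa).
  rewrite (gact_gapply _ _ (WH j)) mulr_sumr big_mkcond.
  apply: eq_bigr => u _; rewrite -mulrA; case: ifPn => // uA.
  by case: (hopfP _ _ _ (WH j)) => ->; rewrite // !(mul0r, mulr0).
have c0 := fixed_family_free galLK (@gamma_inj G)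
  (fun j g u => (elimT (hopfP _ _ _) (WH j)).2 g u) _ k0.
apply/matrixP=> i j; rewrite mxE.
have {}c0 l : c l = 0.
  apply: c0 => a aw; apply/freeP => //.
    exact: basis_free (vbasisP {: subvs_of (hopf s A)}).
  apply/val_inj; rewrite -[RHS]aw linear_sum.
  by apply: eq_bigr => q _; rewrite linearZ.
have /freeP/(_ (fun i => x i j)) := basis_free (vbasisP {: subvs_of (Lfix s A)}).
apply; apply/val_inj; rewrite -[RHS](c0 j) linear_sum.
by apply: eq_bigr => q _; rewrite linearZ.
Qed.

End FixedFields.

Theorem proposition6p5 (K : fieldType) (L : splittingFieldType K)
    (galLK : galois 1 {:L}) (G : finSkewBraceType) (s : galois_iso L G)
    (A B : {group G}) (sd : semidirect A B)
    (alpha : subvs_of (Lfix s A)) (beta : subvs_of (Lfix s B)) :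
  free_generator (subvs_of (hopf s B)) (LA_hopf s sd) alpha ->
  free_generator (subvs_of (hopf_bar s sd)) (LB_hopf_bar s sd) beta ->
  free_generator (tens (subvs_of (Lfix s A)) (subvs_of (hopf s A)))
    (L_tens s A) (vsval beta)
  /\
  free_generator (subvs_of (hopf s [set: G]%G)) (L_hopf s)
    (vsval alpha * vsval beta).
Proof.
move=> /bij_inj alpha_inj /bij_inj beta_inj.
have [[lA _ _] _ _ _ _] := sd.
have aI h : h \in hopf s B -> gapply s h (vsval alpha) = 0 -> h = 0.
  move=> hB ha; apply: (congr1 vsval (alpha_inj (Subvs hB) 0 _)).
  by transitivity (0 : LA_hopf s sd); [apply/val_inj | rewrite scale0r].
have bI h : h \in hopf_bar s sd -> bapply s A h (vsval beta) = 0 -> h = 0.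
  move=> hB ha; apply: (congr1 vsval (beta_inj (Subvs hB) 0 _)).
  by transitivity (0 : LB_hopf_bar s sd); [apply/val_inj | rewrite scale0r].
split.
  apply: (@inj_linear_bij K _ L).
  - exact: L_tens_scale_linear_l.
  - move=> x; apply: (L_tens_scale_inj (subvsP beta) bI galLK).
  (* The bound needed is [#|A| * dim L^A <= dim H_A * dim L^A]. *)
  rewrite (dim_Lfix s lA) dimvf mulnC.
  apply: leq_mul; rewrite dimvf //.
  exact: leq_card_dim_hopf.
apply: (@inj_linear_bij K _ L).
- move=> c h h'; rewrite -[LHS]/(gapply s (vsval (c *: h + h')) _) linearP.
  exact: gapply_linear_l.
- move=> h ha; apply/val_inj.
  exact: (gapply_mul_inj (subvsP alpha) (subvsP beta) aI bI (subvsP h) ha).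
rewrite (dim_Lfix s (@left_ideal_setT G)) dimvf.
(* The field fixed by all of [G] is [K], so [L] has dimension [#|G|]. *)
have -> : \dim (Lfix s [set: G]%G) = 1.
  apply/eqP; rewrite -(dimv1 L) eqn_leq !dimvS ?sub1v //.
  apply/subvP=> t /LfixP ft; apply: (Lfix_all galLK) => g.
  by apply: ft; rewrite inE.
by rewrite muln1 leq_card_dim_hopf //; apply: left_ideal_setT.
Qed.
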